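(* For all integers $t,k\ge 0$ we have $w(t,k)=F(t,k)$. That is, $$\dim W_t(t+2k)=\frac{t+1}{t+k+1}\binom{t+2k}{k}.$$
   Context: A Temperley-Lieb diagram $t\to n$ is a planar non-crossing perfect matching (up to isotopy) of $t$ points on a bottom line and $n$ points on a top line, drawn in the strip between the lines; it is monic if every bottom point is joined to a top point. The cell module $W_t(n)$ of the Temperley-Lieb algebra $TL_n(q)$ has basis the monic diagrams $t\to n$. For $t,k\ge0$, $w(t,k):=\dim W_t(t+2k)$, the number of monic diagrams $t\to t+2k$ (with $w(0,0)=1$, the empty diagram). For $t,k\ge 0$, $F(t,k):=\binom{t+2k}{k}-\binom{t+2k}{k-1}$ (with $\binom{m}{-1}=0$), which equals $\frac{t+1}{t+k+1}\binom{t+2k}{k}$. *)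

(* Defs.v *)
From HB Require Import structures.
From mathcomp Require Import all_boot all_order all_algebra.

Set Implicit Arguments.
Unset Strict Implicit.
Unset Printing Implicit Defensive.

Import GRing.Theory.
Local Open Scope ring_scope.

(* [inl i] is the i-th point of the bottom line and [inr j] the j-th point of
   the top line, both numbered from left to right. *)
Definition point (t n : nat) : finType := ('I_t + 'I_n)%type.

(* Rank of a point when the boundary of the strip is traversed once: the
   bottom line from left to right, then the top line from right to left. *)
Definition boundary_pos (t n : nat) (p : point t n) : nat :=
  match p with
  | inl i => i
  | inr j => (t + rev_ord j)%N
  end.

(* A perfect matching is encoded by the fixed-point-free involution sending
   each point to its partner. *)
Definition perfect_matching (t n : nat) (m : {ffun point t n -> point t n}) :
    bool :=
  [forall p, (m p != p) && (m (m p) == p)].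

(* Two strands of the strip can be drawn disjointly iff their endpoints do not
   alternate along the boundary; an isotopy class of planar diagrams is
   determined by the matching of its endpoints. *)
Definition noncrossing (t n : nat) (m : {ffun point t n -> point t n}) : bool :=
  [forall p, forall q,
    ~~ [&& boundary_pos p < boundary_pos q,
           boundary_pos q < boundary_pos (m p) &
           boundary_pos (m p) < boundary_pos (m q)]%N].

Definition TL_diagram (t n : nat) : finType :=
  {m : {ffun point t n -> point t n} | perfect_matching m && noncrossing m}.

Definition is_top (t n : nat) (p : point t n) : bool :=
  if p is inr _ then true else false.

Definition monic (t n : nat) (d : TL_diagram t n) : bool :=
  [forall i : 'I_t, is_top (val d (inl i))].

Definition monic_diagram (t n : nat) : finType := {d : TL_diagram t n | monic d}.

(* The underlying vector space of the cell module: the K-linear combinations of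
   monic diagrams t -> n. The action of TL_n(q) plays no role in its
   dimension. *)
Definition W (K : fieldType) (t n : nat) : vectType K :=
  {ffun monic_diagram t n -> K^o}.

Definition w (K : fieldType) (t k : nat) : nat := \dim {: W K t (t + 2 * k)}.

Lemma w_card (K : fieldType) (t k : nat) :
  w K t k = #|monic_diagram t (t + 2 * k)|.
Proof. by rewrite /w dimvf /dim /= muln1. Qed.

(* Integer-valued, so that the subtraction is not truncated. *)
Definition F (t k : nat) : int :=
  'C(t + 2 * k, k)%:Z - (if k is j.+1 then 'C(t + 2 * k, j) else 0%N)%:Z.

(* Main.v *)
Require Import Defs.
From HB Require Import structures.
From mathcomp Require Import all_boot all_order all_algebra.
From mathcomp Require Import perm zify ring.

(** Read the boundary of the strip once around: the bottom points from left to
right, then the top points from right to left. Take the first top point [p] met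
on this walk (the rightmost one), next to the last bottom point [q]. In a monic
diagram [t -> n.+1] the strand at [p] either goes to another top point, and then
bending [p] down to the bottom line gives a monic diagram [t.+1 -> n]; or it
goes to a bottom point, which can only be [q], since a strand from [p] to an
earlier bottom point would cross the one that joins [q] to the top. In that
case deleting the strand gives a monic diagram [t.-1 -> n]. Both operations are
bijective, so the number of monic diagrams satisfies the ballot recurrence
[d t n.+1 = d t.+1 n + d t.-1 n], without the last term if [t = 0]
([card_links]), and so does the difference of
binomials, by Pascal's rule ([ballot_binomial]).

No points are ever renumbered. The diagrams are counted inside a fixed type of
involutions: a deleted point stays in the type as a fixed point, and the current
bottom and top lines are two lists [u] and [v] ([links]). Bending moves the head
of [v] to the head of [u]; deleting the strand between the two heads composes
the involution with a transposition. *)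

Set Implicit Arguments.
Unset Strict Implicit.
Unset Printing Implicit Defensive.

Import GRing.Theory.
Local Open Scope ring_scope.

(** * Ballot numbers *)

(** The number of paths of [n] steps [+1] or [-1] from height [t] to height [0]
that never become negative. *)
Fixpoint ballot (t n : nat) : nat :=
  if n is n'.+1 then
    (ballot t.+1 n' + (if t is t'.+1 then ballot t' n' else 0))%N
  else (t == 0%N).

Lemma ballot_small (t n : nat) : (n < t)%N -> ballot t n = 0%N.
Proof.
elim: n t => [|n IHn] [|t] //= ltnt.
by rewrite !IHn //; lia.
Qed.

Lemma ballot_diag (t : nat) : ballot t t = 1%N.
Proof. by elim: t => //= t IHt; rewrite IHt ballot_small. Qed.

(** The middle binomials of an odd row agree; this is the reflection at the
boundary [t = 0], where the ballot recurrence loses a term. *)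
Lemma F_boundary (k : nat) : F 0 k.+1 = F 1 k.
Proof.
rewrite /F (_ : 0 + 2 * k.+1 = (1 + 2 * k).+1)%N; last by lia.
have mid : 'C(1 + 2 * k, k.+1) = 'C(1 + 2 * k, k).
  by rewrite -bin_sub; [congr 'C(_, _); lia | lia].
rewrite binS mid; case: k {mid} => [|k]; first by rewrite !bin0.
by rewrite binS !PoszD; ring.
Qed.

Lemma F_rec (t k : nat) : F t.+1 k.+1 = F t.+2 k + F t k.+1.
Proof.
rewrite /F (_ : t.+1 + 2 * k.+1 = (t + 2 * k.+1).+1)%N; last by lia.
rewrite (_ : t.+2 + 2 * k = t + 2 * k.+1)%N; last by lia.
rewrite binS; case: k => [|k]; first by rewrite !bin0 PoszD; ring.
by rewrite binS !PoszD; ring.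
Qed.

Lemma ballot_binomial (t k : nat) : (ballot t (t + 2 * k))%:Z = F t k.
Proof.
move Dn: (t + 2 * k)%N => n; elim: n t k Dn => [|n IHn] t k Dn.
  by have [-> ->] : t = 0%N /\ k = 0%N by lia.
case: k Dn => [|k] Dn.
  by rewrite -Dn muln0 addn0 ballot_diag /F bin0 subr0.
case: t Dn => [|t] Dn /=.
  by rewrite addn0 F_boundary (IHn _ k) //; lia.
by rewrite PoszD F_rec (IHn _ k) ?(IHn _ k.+1) //; lia.
Qed.

Lemma F_quotient (t k : nat) :
  (F t k)%:~R = (t + 1)%:R / (t + k + 1)%:R * 'C(t + 2 * k, k)%:R :> rat.
Proof.
have nz : (t + k + 1)%:R != 0 :> rat by rewrite Num.Theory.pnatr_eq0; lia.
apply: (mulfI nz); rewrite mulrA mulrCA divff // mulr1.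
rewrite /F; case: k nz => [|k] _; first by rewrite subr0 addn0.
(* Absorption makes the two binomials multiples of the same one. *)
have := mul_bin_left (t + 2 * k.+1) k.
rewrite (_ : t + 2 * k.+1 - k = t + k.+1 + 1)%N; last by lia.
move/(congr1 (fun n : nat => n%:R : rat)); rewrite !natrM => low.
rewrite rmorphB /= mulrBr -!pmulrn -low -mulrBl.
by congr (_ * _); rewrite !natrD; ring.
Qed.

(** * Counting link patterns *)

Section Links.

Variables (T : finType) (pos : T -> nat).
Implicit Types (m : {ffun T -> T}) (u v : seq T).

Definition crossing_free m : bool :=
  [forall p, forall q,
    ~~ [&& pos p < pos q, pos q < pos (m p) & pos (m p) < pos (m q)]%N].

Lemma crossing_freeP m :
  reflect (forall p q, (pos p < pos q)%N -> (pos q < pos (m p))%N ->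
             (pos (m p) < pos (m q))%N -> False)
          (crossing_free m).
Proof.
apply: (iffP forallP) => [cf p q pq qp pq' | cf p].
  by have /forallP/(_ q) := cf p; rewrite pq qp pq'.
by apply/forallP => q; apply/negP => /and3P[]; apply: cf.
Qed.

(** The monic diagrams from the line [u] to the line [v], as involutions of the
ambient type. The list [u] runs away from the corner where the two lines
meet on the boundary and [v] starts there, so that the heads of [u] and [v] are
adjacent and the boundary order is that of [catrev u v]. *)
Definition links u v : {set {ffun T -> T}} :=
  [set m : {ffun T -> T} |
    [&& [forall p, m (m p) == p], [forall p, (m p != p) == (p \in u ++ v)],
        crossing_free m & all (fun p => m p \in v) u]].

Lemma linksP u v m :
  reflect [/\ involutive m, forall p, (m p != p) = (p \in u) || (p \in v),
              crossing_free m & {in u, forall p, m p \in v}]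
          (m \in links u v).
Proof.
rewrite inE; apply: (iffP and4P) => [[/forallP mK /forallP fx cf /allP up] |].
  split=> // [p | p]; first exact/eqP.
  by rewrite (eqP (fx p)) mem_cat.
case=> mK fx cf up; split=> //; last exact/allP.
  by apply/forallP => p; rewrite mK.
by apply/forallP => p; rewrite fx mem_cat.
Qed.

Definition boundary_sorted u v : bool :=
  pairwise (fun x y => pos x < pos y)%N (catrev u v).

Lemma links_nil u : #|links u [::]| = (u == [::]).
Proof.
case: u => [|q u] /=; last first.
  apply: eq_card0 => m; apply/negP => /linksP[_ _ _ up].
  by have := up q (mem_head _ _).
rewrite (_ : links _ _ = [set finfun id]) ?cards1 //.
apply/setP => m; rewrite in_set1; apply/linksP/eqP => [[_ fx _ _] | ->].
  by apply/ffunP => p; rewrite ffunE; apply/eqP; rewrite -[_ == _]negbK fx.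
split=> // [p | p | ]; rewrite ?ffunE ?eqxx //.
apply/crossing_freeP => p q; rewrite !ffunE => pq qp.
by have := ltn_trans pq qp; rewrite ltnn.
Qed.

(** Bending the first point of [v] down to the line [u] keeps the matching, and
is possible exactly if the strand at that point does not end in [u]. *)
Lemma links_bend u v p : boundary_sorted u (p :: v) ->
  [set m in links u (p :: v) | m p \notin u] = links (p :: u) v.
Proof.
rewrite /boundary_sorted catrevE pairwise_cat => /and3P[/allrelP srt _ _].
have disj x : x \in v -> x \notin u.
  move=> xv; apply/negP => xu.
  by have := srt x x; rewrite mem_rev xu inE xv orbT ltnn => /(_ isT isT).
apply/setP => m; rewrite [LHS]inE; apply/andP/linksP.
  case=> /linksP[mK fx cf up] mpu; split=> // [x | x].
    by rewrite fx !inE orbCA orbA.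
  have fxp : m p != p by rewrite fx mem_head orbT.
  rewrite inE => /predU1P[-> | xu].
    have : m (m p) != m p by rewrite mK eq_sym.
    by rewrite fx (negPf mpu) inE (negPf fxp).
  have := up x xu; rewrite inE => /predU1P[mx | //].
  by move: mpu; rewrite -mx mK xu.
case=> mK fx cf up; split; last by apply/disj/up/mem_head.
apply/linksP; split=> // [x | x xu].
  by rewrite fx !inE orbCA orbA.
by rewrite inE up ?orbT // inE xu orbT.
Qed.

(** Joins [p] and [q] if [m] fixes both, and turns them back into fixed points if
[m] joins them. Being its own inverse, it matches the diagrams with the strand
to those without it. *)
Definition toggle (p q : T) m : {ffun T -> T} := [ffun x => tperm p q (m x)].

Lemma toggleK p q : involutive (toggle p q).
Proof. by move=> m; apply/ffunP => x; rewrite !ffunE tpermK. Qed.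

Lemma toggle_fixed p q m : m p = p -> m q = q ->
  toggle p q m p = q /\ toggle p q m q = p.
Proof. by move=> mp mq; rewrite !ffunE mp mq tpermL tpermR. Qed.

Lemma toggle_joined p q m : m p = q -> m q = p ->
  toggle p q m p = p /\ toggle p q m q = q.
Proof. by move=> mp mq; rewrite !ffunE mp mq tpermL tpermR. Qed.

(** An involution that preserves the pair [p], [q] commutes with the
transposition, whether it fixes or joins the two points. *)
Lemma toggle_involutive p q m : involutive m ->
  (m p = p /\ m q = q) \/ (m p = q /\ m q = p) -> involutive (toggle p q m).
Proof.
move=> mK pair x; rewrite !ffunE (inj_tperm p q _ (inv_inj mK)) mK.
by case: pair => -[-> ->]; rewrite 1?[tperm q p]tpermC tpermK.
Qed.

Variant toggle_spec (p q : T) m x : T -> Prop :=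
  | ToggleFst of x = p : toggle_spec p q m x (toggle p q m p)
  | ToggleSnd of x = q : toggle_spec p q m x (toggle p q m q)
  | ToggleOff of x != p & x != q : toggle_spec p q m x (m x).

Lemma toggleP p q m x : involutive m ->
  (m p = p /\ m q = q) \/ (m p = q /\ m q = p) ->
  toggle_spec p q m x (toggle p q m x).
Proof.
move=> mK pair; have [->|xp] := eqVneq x p; first exact: ToggleFst.
have [->|xq] := eqVneq x q; first exact: ToggleSnd.
suff -> : toggle p q m x = m x by exact: ToggleOff.
have mI := inj_eq (inv_inj mK).
have [mxp mxq] : m x != p /\ m x != q.
  by rewrite -[p]mK -[q]mK !mI; case: pair => -[-> ->].
by rewrite ffunE tpermD // eq_sym.
Qed.

Section Cup.

Variables (u v : seq T) (p q : T).
Hypothesis srt : boundary_sorted (q :: u) (p :: v).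

Lemma cup_order :
  [/\ (pos q < pos p)%N, {in u, forall x, pos x < pos q}%N
    & {in v, forall x, pos p < pos x}%N].
Proof.
move: srt; rewrite /boundary_sorted catrevE rev_cons cat_rcons pairwise_cat.
case/and3P=> /allrelP uqv _ /= /and3P[/andP[qp _] /allP pv _].
by split=> // x xu; apply: uqv; rewrite ?mem_rev // mem_head.
Qed.

Lemma cup_notin :
  [/\ q != p, (p \in u) || (p \in v) = false & (q \in u) || (q \in v) = false].
Proof.
have [qp uq pv] := cup_order; split.
- by apply/eqP => e; move: qp; rewrite e ltnn.
- by apply/negP => /orP[/uq|/pv]; lia.
by apply/negP => /orP[/uq|/pv]; lia.
Qed.

Lemma links_fix_cup m : m \in links u v -> m p = p /\ m q = q.
Proof.
have [_ pN qN] := cup_notin; case/linksP=> _ fx _ _.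
by split; apply/eqP; rewrite -[_ == _]negbK fx ?pN ?qN.
Qed.

(** A strand from the first point of [v] into [u] ends at the head of [u]: every
other end would cut the head of [u] off from [v]. *)
Lemma links_cup m :
  m \in links (q :: u) (p :: v) -> m p \in q :: u -> m p = q.
Proof.
have [qp uq pv] := cup_order; case/linksP=> mK fx /crossing_freeP cf up.
rewrite inE => /predU1P[// | mpu].
have mqv : m q \in v.
  have := up q (mem_head _ _); rewrite inE => /predU1P[mq | //].
  by have := uq _ mpu; rewrite -mq mK ltnn.
by case: (cf (m p) q); rewrite ?mK ?uq ?pv.
Qed.

Lemma links_delete_cup m : m \in links (q :: u) (p :: v) -> m p = q ->
  toggle p q m \in links u v.
Proof.
have [_ pN qN] := cup_notin.
case/linksP=> mK fx /crossing_freeP cf up mp; have mq : m q = p by rewrite -mp.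
have pair : (m p = p /\ m q = q) \/ (m p = q /\ m q = p) by right.
have [tp tq] := toggle_joined mp mq; apply/linksP; split.
- exact: toggle_involutive.
- move=> x; case: toggleP => // [->|->|xp xq].
  + by rewrite tp eqxx pN.
  + by rewrite tq eqxx qN.
  by rewrite fx !inE (negPf xp) (negPf xq).
- apply/crossing_freeP => x y; case: toggleP => // [->|->|_ _]; rewrite ?tp ?tq;
    try lia.
  by case: toggleP => // [->|->|_ _]; rewrite ?tp ?tq; try lia; apply: cf.
move=> x xu; case: toggleP => // [xp|xq|xp xq].
- by rewrite -xp xu in pN.
- by rewrite -xq xu in qN.
have := up x; rewrite inE xu orbT inE => /(_ isT)/predU1P[mx | //].
by case/eqP: xq; rewrite -mp -mx mK.
Qed.

(** Two neighbours on the boundary can be joined without creating a crossing,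
as no endpoint lies between them. *)
Lemma links_insert_cup m : m \in links u v ->
  toggle p q m \in links (q :: u) (p :: v).
Proof.
have [qp uq pv] := cup_order; have [qNp _ _] := cup_notin => ml.
have [mp mq] := links_fix_cup ml; case/linksP: ml => mK fx /crossing_freeP cf up.
have pair : (m p = p /\ m q = q) \/ (m p = q /\ m q = p) by left.
have [tp tq] := toggle_fixed mp mq.
have tK := toggle_involutive mK pair.
have tE x : (toggle p q m x != x) = (x \in q :: u) || (x \in p :: v).
  case: toggleP => // [->|->|xp xq]; first by rewrite tp qNp mem_head orbT.
    by rewrite tq eq_sym qNp mem_head.
  by rewrite fx !inE (negPf xp) (negPf xq).
have gap y : toggle p q m y != y -> (pos y <= pos q)%N || (pos p <= pos y)%N.
  rewrite tE !inE -orbA => /or4P[/eqP->|/uq|/eqP->|/pv]; lia.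
apply/linksP; split=> //.
  apply/crossing_freeP => x y xy yx xy'.
  have /gap : toggle p q m y != y.
    by apply/eqP => e; move: xy'; rewrite e; lia.
  have /gap : toggle p q m (toggle p q m x) != toggle p q m x.
    by rewrite tK; apply/eqP => e; move: yx; rewrite -e; lia.
  move: xy yx xy'; case: toggleP => // [->|->|_ _]; rewrite ?tp ?tq; try lia.
  case: toggleP => // [->|->|_ _]; rewrite ?tp ?tq; try lia.
  by move=> xy yx xy'; case: (cf x y).
move=> x; rewrite inE => /predU1P[->|xu]; first by rewrite tq mem_head.
case: toggleP => // [xp|xq|_ _].
- by have := uq x xu; rewrite xp; lia.
- by have := uq x xu; rewrite xq; lia.
by rewrite inE up ?orbT.
Qed.

Lemma links_with_cup :
  [set m in links (q :: u) (p :: v) | m p \in q :: u]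
    = toggle p q @: links u v.
Proof.
apply/setP => m; rewrite [LHS]inE; apply/andP/imsetP => [[ml mpu]|[m' ml ->]].
  exists (toggle p q m); last by rewrite toggleK.
  by apply: links_delete_cup => //; apply: links_cup.
split; first exact: links_insert_cup.
have [mp mq] := links_fix_cup ml.
by rewrite (toggle_fixed mp mq).1 mem_head.
Qed.

End Cup.

Lemma boundary_sorted_behead u v p q :
  boundary_sorted (q :: u) (p :: v) -> boundary_sorted u v.
Proof.
apply: subseq_pairwise; rewrite !catrevE rev_cons cat_rcons.
by apply: cat_subseq; rewrite ?subseq_refl // -[_ :: _]/([:: q; p] ++ v)
  suffix_subseq.
Qed.

Lemma card_links u v :
  boundary_sorted u v -> #|links u v| = ballot (size u) (size v).
Proof.
elim: v u => [|p v IHv] u srt; first by rewrite links_nil /= size_eq0.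
rewrite -(cardsID [set m : {ffun T -> T} | m p \in u]) addnC /=.
congr addn.
  rewrite -[(size u).+1]/(size (p :: u)) -IHv // -links_bend //.
  by apply: eq_card => m; rewrite !inE andbC.
case: u srt => [|q u] srt.
  by apply: eq_card0 => m; rewrite !inE andbF.
rewrite /= -(IHv u); last exact: boundary_sorted_behead srt.
transitivity #|toggle p q @: links u v|; last first.
  exact/card_imset/inv_inj/toggleK.
rewrite -links_with_cup //.
by apply: eq_card => m; rewrite !inE.
Qed.

End Links.

(** * Diagrams as link patterns *)

Section Diagrams.

Variables t n : nat.

Definition bottom_line : seq (point t n) := rev [seq inl i | i <- enum 'I_t].

Definition top_line : seq (point t n) := [seq inr j | j <- rev (enum 'I_n)].

Lemma mem_bottom_line (p : point t n) : (p \in bottom_line) = ~~ is_top p.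
Proof.
rewrite mem_rev; case: p => [i|j] /=.
  by rewrite mem_map ?mem_enum // => x y [].
by apply/mapP => -[].
Qed.

Lemma mem_top_line (p : point t n) : (p \in top_line) = is_top p.
Proof.
case: p => [i|j] /=; first by apply/mapP => -[].
by rewrite mem_map ?mem_rev ?mem_enum // => x y [].
Qed.

Lemma boundary_sorted_lines :
  boundary_sorted (@boundary_pos t n) bottom_line top_line.
Proof.
have enum_lt k : pairwise (fun i j : 'I_k => i < j)%N (enum 'I_k).
  rewrite -(pairwise_map (@nat_of_ord k) ltn) val_enum_ord.
  by rewrite -sorted_pairwise ?iota_ltn_sorted //; apply: ltn_trans.
rewrite /boundary_sorted catrevE revK pairwise_cat.
rewrite (pairwise_map inl) (pairwise_map inr).
apply/and3P; split; last 1 first.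
- rewrite -sorted_pairwise ?rev_sorted; last by move=> i j k; apply: ltn_trans.
  apply: pairwise_sorted; apply: sub_pairwise (enum_lt n) => i j /= ij.
  by have := ltn_ord j; lia.
- apply/allrelP => _ _ /mapP[i _ ->] /mapP[j _ ->] /=.
  by have := ltn_ord i; lia.
exact: enum_lt.
Qed.

Lemma card_monic_diagram : #|monic_diagram t n| = ballot t n.
Proof.
have -> : ballot t n = ballot (size bottom_line) (size top_line).
  by rewrite size_rev (size_map inl) (size_map inr) size_rev !size_enum_ord.
rewrite -(card_links boundary_sorted_lines) card_sig -(card_image val_inj).
apply: eq_card => m; apply/imageP/linksP.
  case=> d; rewrite inE => /forallP mon ->.
  have /andP[/forallP pm nc] := valP d.
  split=> [p|p||p].
  - by have /andP[_ /eqP] := pm p.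
  - by have /andP[-> _] := pm p; rewrite mem_bottom_line mem_top_line orNb.
  - exact: nc.
  rewrite mem_bottom_line mem_top_line; case: p => [i _|//]; exact: mon.
case=> mK fx nc up.
have dm : perfect_matching m && noncrossing m.
  rewrite [noncrossing m]nc andbT; apply/forallP => p.
  by rewrite mK eqxx fx mem_bottom_line mem_top_line orNb.
exists (exist _ m dm) => //.
rewrite inE; apply/forallP => i /=.
by rewrite -mem_top_line up // mem_bottom_line.
Qed.

End Diagrams.

Theorem theorem4p7 (K : fieldType) (t k : nat) :
  (w K t k)%:Z = F t k /\
  (\dim {: W K t (t + 2 * k)})%:R =
    (t + 1)%:R / (t + k + 1)%:R * 'C(t + 2 * k, k)%:R :> rat.
Proof.
have wF : (w K t k)%:Z = F t k.
  by rewrite w_card card_monic_diagram ballot_binomial.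
by split=> //; rewrite -F_quotient -wF.
Qed.
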